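(* For each integer $k\ge 2$ let \[ T(k):=\sum_{\substack{k_1+\cdots+k_r=k\\ r\ge1,\ k_i\ge2 \text{ for all } i}}\zeta(k_1,\ldots,k_r). \] Then, as an identity of power series in $x$, \[ 1+\sum_{k=2}^\infty T(k)x^k=\biggl(1+\sum_{n=1}^\infty \zeta^\star(\underbrace{2, \ldots ,2}_n)x^{2n}\biggr) \biggl(1+\sum_{n=1}^\infty \zeta(\underbrace{3, \ldots ,3}_n)x^{3n}\biggr). \]
   Context: For positive integers $k_1,\ldots,k_r$ with $k_r>1$, the multiple zeta value is $\zeta(k_1,\ldots,k_r)=\sum_{0<m_1<\cdots<m_r} m_1^{-k_1}\cdots m_r^{-k_r}$ and the multiple zeta-star value is $\zeta^\star(k_1,\ldots,k_r)=\sum_{0<m_1\le\cdots\le m_r} m_1^{-k_1}\cdots m_r^{-k_r}$. *)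

(* Defs.v *)
From mathcomp Require Import all_boot all_order all_algebra.
From mathcomp Require Import all_classical all_reals all_analysis.

Set Implicit Arguments.
Unset Strict Implicit.
Unset Printing Implicit Defensive.

Import Order.TTheory GRing.Theory Num.Theory.

Local Open Scope classical_set_scope.
Local Open Scope ring_scope.

Section MultipleZeta.
Variable R : realType.

Definition mz_term (k : seq nat) (m : (size k).-tuple nat) : R :=
  \prod_(i < size k) (tnth m i)%:R ^- tnth (in_tuple k) i.

(* [path ltn 0 m] is literally 0 < m_1 < ... < m_r. The sum is the unordered
   sum of a nonnegative family in [0, +oo]; [fine] only reads off its real value,
   which is meaningful for admissible indices (all k_i >= 1 and k_r > 1). *)
Definition mzv (k : seq nat) : R :=
  fine (\esum_(m in [set m : (size k).-tuple nat | path ltn 0%N m])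
          (mz_term m)%:E).

Definition mzsv (k : seq nat) : R :=
  fine (\esum_(m in [set m : (size k).-tuple nat |
                       all (ltn 0%N) m && sorted leq m])
          (mz_term m)%:E).

(* Sum over all compositions of k into r >= 1 parts, each >= 2; the bounds
   r <= k and k_i <= k hold for every such composition, and only serve to make
   the index type finite. *)
Definition mzv_sum (k : nat) : R :=
  \sum_(1 <= r < k.+1)
    \sum_(t : r.-tuple 'I_k.+1 |
            all (fun i : 'I_k.+1 => 2 <= i)%N t && (\sum_(i <- t) i == k)%N)
      mzv [seq val i | i <- t].

(* A formal power series is identified with its sequence of coefficients. *)
Definition fps := nat -> R.

Definition fps_one : fps := fun N => (N == 0%N)%:R.

Definition fps_add (f g : fps) : fps := fun N => f N + g N.

Definition fps_mul (f g : fps) : fps :=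
  fun N => \sum_(i < N.+1) f i * g (N - i)%N.

(* The series \sum_(n >= n0) c_n x^(d n), for d > 0: only indices n <= N can
   contribute to the coefficient of x^N. *)
Definition fps_sum (n0 d : nat) (c : nat -> R) : fps :=
  fun N => \sum_(n0 <= n < N.+1 | (d * n == N)%N) c n.

End MultipleZeta.

(* Main.v *)
Require Import Defs.
From mathcomp Require Import all_boot all_order all_algebra.
From mathcomp Require Import all_classical all_reals all_analysis.
From mathcomp Require Import ring lra zify.

(* Restrict every summation variable to a finite interval. In the generating
   series of the truncated T(k), an integer m contributes, with z = x / m, the factor
   1 + z^2 + z^3 + ... = (1 - z + z^2) / (1 - z) = (1 + z^3) / (1 - z^2),
   because (1 - z + z^2)(1 + z) = 1 + z^3. The factors 1 / (1 - z^2) multiply to the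
   generating series of the truncated zeta-star values of {2}^n, and the factors
   1 + z^3 to that of the truncated zeta values of {3}^n. So the identity holds
   exactly for truncated sums; these are bounded and nondecreasing, and each
   coefficient involves finitely many of them, so it passes to the limit. *)

Set Implicit Arguments.
Unset Strict Implicit.
Unset Printing Implicit Defensive.

Import Order.TTheory GRing.Theory Num.Theory.
Import numFieldNormedType.Exports.

Local Open Scope classical_set_scope.
Local Open Scope ring_scope.

(** * Formal power series: shifts, products and the recurrences behind the factors *)

Section PowerSeries.
Variable R : realType.
Implicit Types (f g h : fps R) (y : R).

(** Multiplication by x, so that [iter d fps_shift] is multiplication by x^d. *)
Definition fps_shift f : fps R := fun N => if N is n.+1 then f n else 0.

Lemma iter_fps_shift_linear d y f g N :
  iter d fps_shift (fun n => y * f n + g n) N =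
  y * iter d fps_shift f N + iter d fps_shift g N.
Proof. by elim: d N => // d IH [|N] //=; rewrite mulr0 addr0. Qed.

Lemma iter_fps_shift_lt d f N : (N < d)%N -> iter d fps_shift f N = 0.
Proof. by elim: d N => // d IH [|N] //= /IH. Qed.

Lemma iter_fps_shift_add d f N : iter d fps_shift f (d + N) = f N.
Proof. by elim: d. Qed.

Lemma eq_iter_fps_shift d f g : f =1 g -> iter d fps_shift f =1 iter d fps_shift g.
Proof. by move=> fg; elim: d => // d IH [|N] //=. Qed.

Lemma fps_mul_shiftl f g : fps_mul (fps_shift f) g =1 fps_shift (fps_mul f g).
Proof.
case=> [|N]; rewrite /fps_mul /=; first by rewrite big_ord_recl big_ord0 mul0r addr0.
by rewrite big_ord_recl /= mul0r add0r; apply: eq_bigr => i _; rewrite subSS.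
Qed.

Lemma fps_mul_shiftr f g : fps_mul f (fps_shift g) =1 fps_shift (fps_mul f g).
Proof.
case=> [|N]; rewrite /fps_mul /=; first by rewrite big_ord_recl big_ord0 mulr0 addr0.
rewrite big_ord_recr /= subnn mulr0 addr0; apply: eq_bigr => i _.
by rewrite subSn //= -ltnS.
Qed.

Lemma fps_mul_iter_shiftl d f g :
  fps_mul (iter d fps_shift f) g =1 iter d fps_shift (fps_mul f g).
Proof.
elim: d => // d IH N /=; rewrite fps_mul_shiftl.
by case: N => //= n; rewrite IH.
Qed.

Lemma fps_mul_iter_shiftr d f g :
  fps_mul f (iter d fps_shift g) =1 iter d fps_shift (fps_mul f g).
Proof.
elim: d => // d IH N /=; rewrite fps_mul_shiftr.
by case: N => //= n; rewrite IH.
Qed.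

(** The hypothesis is (1 - y x^d) f' = f, and multiplying by [g] preserves it. Stating it as a
    recurrence avoids inverting series. *)
Lemma fps_mul_recl d y f f' g :
  (forall N, f' N = f N + y * iter d fps_shift f' N) ->
  forall N, fps_mul f' g N = fps_mul f g N + y * iter d fps_shift (fps_mul f' g) N.
Proof.
move=> fE N; rewrite -fps_mul_iter_shiftl /fps_mul mulr_sumr -big_split /=.
by apply: eq_bigr => i _; rewrite {1}fE mulrDl mulrA.
Qed.

Lemma fps_mul_recr d y f g g' :
  (forall N, g' N = g N + y * iter d fps_shift g N) ->
  forall N, fps_mul f g' N = fps_mul f g N + y * iter d fps_shift (fps_mul f g) N.
Proof.
move=> gE N; rewrite -fps_mul_iter_shiftr /fps_mul mulr_sumr -big_split /=.
by apply: eq_bigr => i _; rewrite gE mulrDr mulrCA.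
Qed.

Lemma fps_mul_step y f f' g g' :
  (forall N, f' N = f N + y ^+ 2 * iter 2 fps_shift f' N) ->
  (forall N, g' N = g N + y ^+ 3 * iter 3 fps_shift g N) ->
  forall N, fps_mul f' g' N = fps_mul f g N
    + y ^+ 2 * iter 2 fps_shift (fps_mul f' g') N
    + y ^+ 3 * iter 3 fps_shift (fps_mul f g) N.
Proof.
move=> fE gE N.
have E1 := fps_mul_recl g fE.
have E2 := fps_mul_recr f' gE.
(* With z = y x, both sides expand to fg + z^2 f'g + z^3 fg + z^5 f'g. *)
rewrite (eq_iter_fps_shift 2 E2) E2 E1 /=.
case: N => [|[|[|n]]] /=; rewrite ?addr0 ?mulr0 ?addr0 ?addr0 //.
by rewrite (E1 n) /=; ring.
Qed.

(** This is the invertibility of 1 - y^2 x^2: coefficient N of a solution is determined by [f] and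
    by its own coefficient N - 2. *)
Lemma fps_step_unique y f g f' g' :
  f =1 g ->
  (forall N, f' N = f N + y ^+ 2 * iter 2 fps_shift f' N
                    + y ^+ 3 * iter 3 fps_shift f N) ->
  (forall N, g' N = g N + y ^+ 2 * iter 2 fps_shift g' N
                    + y ^+ 3 * iter 3 fps_shift g N) ->
  f' =1 g'.
Proof.
move=> fg fE gE N; elim/ltn_ind: N => N IH.
rewrite fE gE fg (eq_iter_fps_shift 3 fg); congr (_ + _ * _ + _).
by case: N IH => [|[|n]] //= IH; apply: IH.
Qed.

(* That is, h = f (1 + z^2 + z^3 + ...) implies (1 - z^2) h = (1 + z^3) f for z = y x. *)
Lemma fps_geometric_step y f h :
  (forall N, h N = f N + \sum_(2 <= k < N.+1) y ^+ k * f (N - k)%N) ->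
  forall N, h N = f N + y ^+ 2 * iter 2 fps_shift h N
                  + y ^+ 3 * iter 3 fps_shift f N.
Proof.
move=> hE.
(* [W] is (z^2 + z^3 + ...) f. By [WS] it satisfies W = z^2 f + z W, and unfolding this twice gives
   the claim. *)
pose W N : R := \sum_(2 <= k < N.+1) y ^+ k * f (N - k)%N.
have WS N : W N.+2 = y ^+ 2 * f N + y * W N.+1.
  rewrite /W big_nat_recl // subSS subSS subn0; congr (_ + _).
  rewrite mulr_sumr; apply: eq_big_nat => k /andP[k2 kN].
  by rewrite subSS exprS mulrA.
have W1 : W 1 = 0 by rewrite /W big_geq.
have W0 : W 0 = 0 by rewrite /W big_geq.
have {}hE N : h N = f N + W N by exact: hE.
case=> [|[|[|n]]] /=; rewrite !hE ?WS ?W0 ?W1; ring.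
Qed.

Lemma fps_sum_dvd d (c : nat -> R) N : (0 < d)%N ->
  fps_sum 0 d c N = if (d %| N)%N then c (N %/ d)%N else 0.
Proof.
move=> d0; rewrite /fps_sum; case: ifPn => dN.
  rewrite (big_rem (N %/ d)%N); last first.
    by rewrite mem_index_iota ltnS leq_div.
  rewrite mulnC divnK // eqxx big_seq_cond big1 ?Monoid.mulm1 // => n.
  rewrite mem_rem_uniq ?iota_uniq // inE => /andP[/andP[/= nd _] /eqP E].
  by move: nd; rewrite -E mulKn // eqxx.
by rewrite big1 // => n /eqP E; move: dN; rewrite -E dvdn_mulr.
Qed.

Lemma fps_sum_shift d (c : nat -> R) N : (0 < d)%N ->
  fps_sum 0 d c N = (N == 0)%:R * c 0%N
                    + iter d fps_shift (fps_sum 0 d (fun n => c n.+1)) N.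
Proof.
move=> d0; case: (ltnP N d) => Nd.
  rewrite iter_fps_shift_lt // addr0 fps_sum_dvd // divn_small //.
  case: N Nd => [|N] Nd; first by rewrite dvdn0 mul1r.
  by rewrite gtnNdvd // mul0r.
rewrite -(subnKC Nd) iter_fps_shift_add !fps_sum_dvd // dvdn_addr // divnDl // divnn d0.
by rewrite add1n addn_eq0 eqn0Ngt d0 /= mul0r add0r.
Qed.

(** Raising n by one costs a factor x^d. The sequence [e] is left free: it will be [c'] when the new
    smallest variable may repeat (star values) and [c] when it may not. *)
Lemma fps_sum_rec d y (c e c' : nat -> R) : (0 < d)%N ->
  c' 0%N = c 0%N -> (forall n, c' n.+1 = y * e n + c n.+1) ->
  forall N, fps_sum 0 d c' N =
    fps_sum 0 d c N + y * iter d fps_shift (fps_sum 0 d e) N.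
Proof.
move=> d0 c0 cS N; rewrite fps_sum_shift // [in RHS]fps_sum_shift // c0 -addrA.
congr (_ + _); rewrite addrC -iter_fps_shift_linear; apply: eq_iter_fps_shift => n.
by rewrite /fps_sum mulr_sumr -big_split; apply: eq_bigr => i _.
Qed.

Lemma fps_sum_one d (c : nat -> R) : (0 < d)%N ->
  c 0%N = 1 -> (forall n, c n.+1 = 0) -> fps_sum 0 d c =1 fps_one R.
Proof.
move=> d0 c0 cS; case=> [|N]; first by rewrite fps_sum_dvd // dvdn0 div0n.
rewrite fps_sum_dvd // /fps_one; case: ifP => // dN.
by rewrite -(prednK (_ : 0 < N.+1 %/ d)%N) // divn_gt0 // dvdn_leq.
Qed.

Lemma fps_mul1 f : fps_mul (fps_one R) f =1 f.
Proof.
move=> N; rewrite /fps_mul big_ord_recl subn0 mul1r big1 ?addr0 // => i _.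
by rewrite mul0r.
Qed.

Lemma eq_fps_mul f f' g g' : f =1 f' -> g =1 g' -> fps_mul f g =1 fps_mul f' g'.
Proof. by move=> ff gg N; apply: eq_bigr => i _; rewrite ff gg. Qed.

Lemma fps_sum_split d (c : nat -> R) : c 0%N = 1 ->
  fps_add (fps_one R) (fps_sum 1 d c) =1 fps_sum 0 d c.
Proof.
move=> c0 N; rewrite /fps_add /fps_one /fps_sum.
rewrite [RHS]big_ltn_cond // muln0 eq_sym.
by case: eqP => _; rewrite ?add0r ?c0.
Qed.

End PowerSeries.

(** * Truncated multiple zeta and zeta-star sums, and their limits *)

Section Truncation.
Variable R : realType.
Implicit Types (s : bool) (ks : seq nat) (b a : nat).

(* The variables m_i range over ]a, a + b], weakly increasing if [s] and strictly
   increasing otherwise; the recursion splits on whether m_1 = a + 1. *)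
Fixpoint mz_trunc s ks : nat -> nat -> R :=
  if ks is k :: ks' then
    fix g b a := if b is b'.+1 then
      a.+1%:R ^- k * (if s then mz_trunc s ks' b'.+1 a else mz_trunc s ks' b' a.+1)
      + g b' a.+1 else 0
  else fun _ _ => 1.

Definition mz_rel s : rel nat := fun x y => (x + ~~ s <= y)%N.

(* The path starts at [a + s], so that both relations force m_1 > a. *)
Definition mz_range s b a r : set (r.-tuple nat) :=
  [set m : r.-tuple nat | path (mz_rel s) (a + s)%N m
                          && all (fun x => x <= a + b)%N m].
Arguments mz_range : clear implicits.

Lemma mz_range0 s b a : mz_range s b a 0 = [set [tuple]].
Proof. by apply/seteqP; split=> m; rewrite [m]tuple0. Qed.

Lemma mz_range_cons s b a r x (m : r.-tuple nat) :
  mz_range s b a r.+1 (cons_tuple x m) <->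
  [/\ (a < x)%N, path (mz_rel s) x m, (x <= a + b)%N &
      all (fun x => x <= a + b)%N m].
Proof.
have -> : mz_range s b a r.+1 (cons_tuple x m) =
    (mz_rel s (a + s)%N x && path (mz_rel s) x m) &&
    ((x <= a + b)%N && all (fun x => x <= a + b)%N m) by [].
have -> : mz_rel s (a + s) x = (a < x)%N.
  by rewrite /mz_rel -addnA (_ : s + ~~ s = 1)%N ?addn1 //; case: s.
by split=> [/andP[/andP[-> ->] /andP[-> ->]]|[-> -> -> ->]].
Qed.

Lemma mz_rangeS0 s a r : mz_range s 0 a r.+1 = set0.
Proof.
apply/seteqP; split=> // m; case/tupleP: m => x m /mz_range_cons[H _ K _].
by exfalso; lia.
Qed.

(** This mirrors the recursion of [mz_trunc]: either m_1 > a + 1, or m_1 = a + 1 and the remaining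
    entries may still equal a + 1 exactly in the weak case. *)
Lemma mz_rangeSS s b a r : mz_range s b.+1 a r.+1 =
  mz_range s b a.+1 r.+1 `|`
  cons_tuple a.+1 @` (if s then mz_range s b.+1 a r else mz_range s b a.+1 r).
Proof.
apply/seteqP; split=> m.
  case/tupleP: m => x m /mz_range_cons[H P K A].
  have [ax|xa] := ltnP a.+1 x.
    by left; apply/mz_range_cons; rewrite addSnnS; split.
  have E : x = a.+1 by lia.
  right; exists m; last by apply: val_inj => /=; rewrite E.
  move: P A; rewrite {}E; case: s; rewrite /mz_range => P A; apply/andP; split => //.
  - by rewrite addn1.
  - by rewrite addn0.
  - by rewrite addSnnS.
case=> [|[m' Hm <-]].
  case/tupleP: m => x m /mz_range_cons[H P K A].
  by apply/mz_range_cons; rewrite -addSnnS; split=> //; exact: ltnW.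
apply/mz_range_cons; case: s Hm => /andP[]; rewrite ?addn1 ?addn0 ?addSnnS => P A;
  by split=> //; rewrite addnS ltnS leq_addr.
Qed.

Lemma mz_range_disj s b a r (A : set (r.-tuple nat)) :
  mz_range s b a.+1 r.+1 `&` cons_tuple a.+1 @` A `<=` set0.
Proof.
by move=> m [Hm [m' _ E]]; move: Hm; rewrite -E => /mz_range_cons[]; rewrite ltnn.
Qed.

Lemma finite_mz_range s b a r : finite_set (mz_range s b a r).
Proof.
elim: r b a => [|r IHr] b a; first by rewrite mz_range0.
elim: b a => [|b IHb] a; first by rewrite mz_rangeS0.
rewrite mz_rangeSS finite_setU; split; first exact: IHb.
by apply: finite_image; case: ifP => _; apply: IHr.
Qed.

Lemma sub_mz_range s b c a r : (b <= c)%N -> mz_range s b a r `<=` mz_range s c a r.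
Proof.
move=> bc m /andP[H A]; rewrite /mz_range /= H /=.
by apply: sub_all A => x; lia.
Qed.

Lemma mz_term_ge0 ks (m : (size ks).-tuple nat) : 0 <= mz_term R m.
Proof. by apply: prodr_ge0 => i _; rewrite invr_ge0 exprn_ge0. Qed.

Lemma mz_term_cons k ks x (m : (size ks).-tuple nat) :
  @mz_term R (k :: ks) (cons_tuple x m) = x%:R ^- k * mz_term R m.
Proof.
rewrite /mz_term /= big_ord_recl; congr (_ * _).
by apply: eq_bigr => i _; rewrite !(tnth_nth 0%N).
Qed.

Lemma fsum_mz_range s ks b a :
  \sum_(m \in mz_range s b a (size ks)) mz_term R m = mz_trunc s ks b a.
Proof.
elim: ks b a => [|k ks IHk] b a.
  by rewrite mz_range0 fsbig_set1 /mz_term big_ord0.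
elim: b a => [|b IHb] a; first by rewrite mz_rangeS0 fsbig_set0.
rewrite [size _]/= mz_rangeSS fsbigU0; first last.
- exact: mz_range_disj.
- by apply: finite_image; case: ifP => _; apply: finite_mz_range.
- exact: finite_mz_range.
have -> : \sum_(m \in mz_range s b a.+1 (size ks).+1) @mz_term R (k :: ks) m =
          mz_trunc s (k :: ks) b a.+1 by exact: IHb.
rewrite [RHS]/= addrC; congr (_ + _).
rewrite fsbig_image; last by move=> m m' _ _ [] /val_inj.
under eq_fsbigr do rewrite mz_term_cons.
by rewrite -mulr_fsumr; congr (_ * _); case: s IHk {IHb} => IHk; exact: IHk.
Qed.

Lemma mz_trunc_ge0 s ks b a : 0 <= mz_trunc s ks b a.
Proof.
elim: ks b a => // k ks IHk; elim=> [|b IHb] a //=.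
by rewrite addr_ge0 ?mulr_ge0 ?invr_ge0 ?exprn_ge0 //; case: ifP.
Qed.

(** With x = a + 1 this is x^-2 <= 2 / (x (x + 1)), that is, x >= 1. The constant 2 is forced by x =
    1. *)
Lemma invf_sqr_telescope a :
  a.+1%:R ^- 2 + 2 / a.+2%:R <= 2 / a.+1%:R :> R.
Proof.
have -> : a.+2%:R = a.+1%:R + 1 :> R by rewrite -natr1.
have : 1 <= a.+1%:R :> R by rewrite ler1n.
move: a.+1%:R => x x1.
have x0 : 0 < x by lra.
have x10 : 0 < x + 1 by lra.
rewrite -subr_ge0.
have -> : 2 / x - (x ^- 2 + 2 / (x + 1)) = (x - 1) / (x ^+ 2 * (x + 1)).
  by field; rewrite !gt_eqF.
by apply: divr_ge0; [lra | rewrite mulr_ge0 ?exprn_ge0 // ltW].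
Qed.

(** The inner sums are bounded uniformly and the sum over m_1 telescopes. The factor 2 / (a + 1),
    sharper than a constant, is what makes the induction on [b] close. *)
Lemma mz_trunc_cons_le s k ks b a : all (leq 2) (k :: ks) ->
  (forall b a, mz_trunc s ks b a <= 2 ^+ size ks) ->
  mz_trunc s (k :: ks) b a <= 2 ^+ size ks * (2 / a.+1%:R).
Proof.
move=> /andP[k2 _] IHk; elim: b a => [|b IHb] a /=.
  by rewrite mulr_ge0 ?exprn_ge0 ?divr_ge0.
apply: le_trans (_ : 2 ^+ size ks * (a.+1%:R ^- 2) + 2 ^+ size ks * (2 / a.+2%:R) <= _).
  apply: lerD; last exact: IHb.
  rewrite mulrC; apply: ler_pM; first by case: ifP => _; apply: mz_trunc_ge0.
  - by rewrite invr_ge0 exprn_ge0.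
  - by case: ifP.
  by rewrite lef_pV2 ?posrE ?exprn_gt0 // ler_weXn2l // ler1n.
by rewrite -mulrDr ler_pM2l ?exprn_gt0 // invf_sqr_telescope.
Qed.

Lemma mz_trunc_le s ks b a : all (leq 2) ks -> mz_trunc s ks b a <= 2 ^+ size ks.
Proof.
elim: ks b a => [|k ks IHk] b a ks2; first by rewrite expr0.
have [_ ks2'] := andP ks2.
apply: le_trans (mz_trunc_cons_le b a ks2 _) _ => [b' a'|]; first exact: IHk.
rewrite [size (k :: ks)]/= exprSr ler_pM2l ?exprn_gt0 // ler_pdivrMr // ler_peMr // ler1n.
by [].
Qed.

(** The union of the ranges with a = 0. Starting the path at [s], read as 1 or 0, forces m_1 > 0 for
    both relations. *)
Definition mz_domain s r : set (r.-tuple nat) :=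
  [set m : r.-tuple nat | path (mz_rel s) s m].
Arguments mz_domain : clear implicits.

(** The truncation ranges are finite subsets of the domain, and every finite subset lies in one of
    them. *)
Lemma esum_mz_domain s ks :
  \esum_(m in mz_domain s (size ks)) (mz_term R m)%:E =
  ereal_sup (range (fun b => (mz_trunc s ks b 0)%:E)).
Proof.
apply/eqP; rewrite eq_le; apply/andP; split.
  apply: ge_ereal_sup => _ [X [finX XS] <-].
  suff [b Xb] : exists b, X `<=` mz_range s b 0 (size ks).
    apply: le_trans (_ : (mz_trunc s ks b 0)%:E <= _)%E; last first.
      by apply: ereal_sup_ubound; exists b.
    rewrite -fsum_mz_range -fsumEFin; last exact: finite_mz_range.
    apply: lee_fsum_nneg_subset => //; first exact: finite_mz_range.
      by move=> x; rewrite !inE; apply: Xb.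
    by move=> x _; rewrite lee_fin mz_term_ge0.
  have /finite_seqP[l lE] := finX.
  (* The bound is the largest entry of any tuple in the finite set. *)
  exists (\max_(m <- l) \max_(x <- tval m) x)%N => m Xm.
  have mS := XS _ Xm; apply/andP; split => //.
  apply/allP => x xm; rewrite add0n; move: Xm; rewrite lE /= => ml.
  have := @leq_bigmax_seq _ l xpredT (fun m => \max_(x <- tval m) x)%N m ml isT.
  by apply: leq_trans; exact: (@leq_bigmax_seq _ _ xpredT id).
apply: ge_ereal_sup => _ [b _ <-].
apply: esum_ge; exists (mz_range s b 0 (size ks)).
  split; first exact: finite_mz_range.
  by move=> m /andP[].
by rewrite fsumEFin ?fsum_mz_range //; exact: finite_mz_range.
Qed.

Lemma mz_trunc_nd s ks a : nondecreasing_seq (fun b => mz_trunc s ks b a).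
Proof.
move=> b c bc; rewrite -!fsum_mz_range -lee_fin -!fsumEFin; do ?exact: finite_mz_range.
apply: lee_fsum_nneg_subset; do ?exact: finite_mz_range.
  by move=> x; rewrite !inE; apply: sub_mz_range.
by move=> x _; rewrite lee_fin mz_term_ge0.
Qed.

Lemma mz_trunc_cvg s ks : all (leq 2) ks ->
  mz_trunc s ks b 0 @[b --> \oo] -->
  fine (\esum_(m in mz_domain s (size ks)) (mz_term R m)%:E).
Proof.
move=> ks2; rewrite esum_mz_domain.
set L := ereal_sup _.
(* Since [fine] sends +oo to 0, the uniform bound on truncations has to come before the passage to a
   real limit. *)
have Lfin : L \is a fin_num.
  rewrite ge0_fin_numE.
    apply: le_lt_trans (ltry (2 ^+ size ks)); apply: ge_ereal_sup => _ [b _ <-].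
    by rewrite lee_fin mz_trunc_le.
  apply: le_trans (_ : (mz_trunc s ks 0 0)%:E <= _)%E.
    by rewrite lee_fin mz_trunc_ge0.
  by apply: ereal_sup_ubound; exists 0%N.
have := @ereal_nondecreasing_cvgn R (fun b => (mz_trunc s ks b 0)%:E).
rewrite -/L -(fineK Lfin) => /(_ _)/fine_cvg; apply.
by move=> b c bc; rewrite lee_fin mz_trunc_nd.
Qed.

Lemma mzv_trunc_cvg ks : all (leq 2) ks ->
  mz_trunc false ks b 0 @[b --> \oo] --> mzv R ks.
Proof.
move=> ks2; rewrite /mzv.
suff -> : [set m : (size ks).-tuple nat | path ltn 0%N m] = mz_domain false (size ks).
  exact: mz_trunc_cvg.
by apply/seteqP; split=> m /=; rewrite /mz_domain /=;
  rewrite (@eq_path _ _ ltn) // => x y; rewrite /mz_rel /= addn1.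
Qed.

Lemma mzsv_trunc_cvg ks : all (leq 2) ks ->
  mz_trunc true ks b 0 @[b --> \oo] --> mzsv R ks.
Proof.
move=> ks2; rewrite /mzsv.
suff -> : [set m : (size ks).-tuple nat | all (ltn 0%N) m && sorted leq m] =
          mz_domain true (size ks).
  exact: mz_trunc_cvg.
have pathE (m : seq nat) : path (mz_rel true) true m =
    all (ltn 0%N) m && sorted leq m.
  rewrite (@eq_path _ _ leq); last by move=> x y; rewrite /mz_rel /= addn0.
  by rewrite path_sortedE //; exact: leq_trans.
by apply/seteqP; split=> m /=; rewrite /mz_domain /= pathE.
Qed.

End Truncation.

(** * Sums over compositions with parts at least 2, and their generating series *)

Section Compositions.
Variable R : realType.
Implicit Types (r N : nat) (F G : seq nat -> R).

(* The sum of [F] over the compositions of [N] into [r] parts, all at least 2. *)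
Fixpoint comp_sum r N F : R :=
  if r is r'.+1 then
    \sum_(2 <= k < N.+1) comp_sum r' (N - k) (fun ks => F (k :: ks))
  else (N == 0)%:R * F [::].

Lemma eq_comp_sum r N F G : F =1 G -> comp_sum r N F = comp_sum r N G.
Proof.
elim: r N F G => [|r IH] N F G FG /=; first by rewrite FG.
by apply: eq_bigr => k _; apply: IH.
Qed.

Lemma comp_sumD r N F G :
  comp_sum r N (fun ks => F ks + G ks) = comp_sum r N F + comp_sum r N G.
Proof.
elim: r N F G => [|r IH] N F G /=; first by rewrite mulrDr.
by rewrite -big_split; apply: eq_bigr => k _; rewrite IH.
Qed.

Lemma comp_sumZ r N c F :
  comp_sum r N (fun ks => c * F ks) = c * comp_sum r N F.
Proof.
elim: r N F => [|r IH] N F /=; first by rewrite mulrCA.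
by rewrite mulr_sumr; apply: eq_bigr => k _; rewrite IH.
Qed.

Lemma comp_sum0 r N : comp_sum r N (fun=> 0) = 0.
Proof. by elim: r N => [|r IH] N /=; [rewrite mulr0 | rewrite big1]. Qed.

Lemma comp_sum_eq0 r N F : (N < r)%N -> comp_sum r N F = 0.
Proof.
elim: r N F => // r IH N F Nr /=.
rewrite big_seq big1 // => k; rewrite mem_index_iota => /andP[k2 kN].
by apply: IH; lia.
Qed.

Lemma comp_sum_cvg r N (F : nat -> seq nat -> R) G :
  (forall ks, all (leq 2) ks -> F b ks @[b --> \oo] --> G ks) ->
  comp_sum r N (F b) @[b --> \oo] --> comp_sum r N G.
Proof.
elim: r N F G => [|r IH] N F G FG /=; first by apply: cvgMl_tmp; exact: FG.
rewrite big_seq; under eq_fun do rewrite big_seq.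
apply: cvg_big => [|k]; first exact: add_continuous.
rewrite mem_index_iota => /andP[k2 _].
by apply: IH => ks ks2; apply: FG; rewrite /= k2.
Qed.

Lemma big_tuple_cons n (T : finType) (P : pred (n.+1.-tuple T))
    (F : n.+1.-tuple T -> R) :
  \sum_(t | P t) F t =
  \sum_(x : T) \sum_(t : n.-tuple T | P (cons_tuple x t)) F (cons_tuple x t).
Proof.
rewrite pair_big_dep /= (reindex (fun p : T * n.-tuple T => cons_tuple p.1 p.2)) //.
exists (fun t => (thead t, behead_tuple t)) => [[x t] _|t _] /=.
  by congr (_, _); apply: val_inj.
by rewrite [RHS]tuple_eta; apply: val_inj.
Qed.

(** The bound [B] is arbitrary because the induction replaces N by N - k while the type of the
    entries stays fixed. *)
Lemma comp_sum_tuple r N B F : (N < B)%N ->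
  \sum_(t : r.-tuple 'I_B |
          all (fun i : 'I_B => 2 <= i)%N t && (\sum_(i <- t) i == N)%N)
     F [seq val i | i <- t] = comp_sum r N F.
Proof.
elim: r N F => [|r IH] N F NB /=.
  case: N {NB} => [|N].
    rewrite (big_pred1 [tuple]) ?mul1r // => t.
    by rewrite [t]tuple0 big_nil; apply/esym/eqP.
  by rewrite big_pred0 ?mul0r // => t; rewrite [t]tuple0 /= big_nil.
rewrite big_tuple_cons (big_nat_widen _ _ B) // (big_nat_widenl _ 0) // big_mkord.
rewrite [RHS]big_mkcond; apply: eq_bigr => k _.
case: ifPn => [/andP[/= kN k2]|kN].
  rewrite -IH; last by lia.
  apply: eq_bigl => t; rewrite /= k2 big_cons; congr (_ && _).
  by apply/eqP/eqP; lia.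
rewrite big_pred0 // => t; rewrite /= big_cons; apply/negP => /andP[/andP[k2 _] /eqP kN'].
by move: kN; rewrite k2 /=; lia.
Qed.

(** The empty composition r = 0 is included and gives the constant term; at most N parts can
    occur. *)
Definition comps_series F N : R := \sum_(0 <= r < N.+1) comp_sum r N F.

Lemma comps_series_widen F N M : (N < M)%N ->
  \sum_(0 <= r < M) comp_sum r N F = comps_series F N.
Proof.
move=> NM; rewrite /comps_series (big_cat_nat (n := N.+1)) //=.
rewrite [X in _ + X](_ : _ = 0) ?addr0 // big_nat big1 //.
by move=> r /andP[Nr _]; apply: comp_sum_eq0.
Qed.

(** The term y^k F(ks) is the case where the first variable takes the new value 1 / y; what remains
    is a composition of N - k. Hence the series is multiplied by 1 + z^2 + z^3 + ... with z = y
    x. *)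
Lemma comps_series_rec F F' y :
  F' [::] = F [::] ->
  (forall k ks, F' (k :: ks) = y ^+ k * F ks + F (k :: ks)) ->
  forall N, comps_series F' N =
    comps_series F N + \sum_(2 <= k < N.+1) y ^+ k * comps_series F (N - k)%N.
Proof.
move=> F0 FS N; rewrite /comps_series big_nat_recl // [in RHS]big_nat_recl //= F0.
rewrite -addrA; congr (_ + _).
rewrite (eq_bigr (fun r => \sum_(2 <= k < N.+1) comp_sum r (N - k) (fun ks => F (k :: ks))
    + \sum_(2 <= k < N.+1) y ^+ k * comp_sum r (N - k) F)); last first.
  move=> r _; rewrite -big_split; apply: eq_bigr => k _.
  rewrite (eq_comp_sum _ _ (FS k)) comp_sumD comp_sumZ addrC //.
rewrite big_split /=; congr (_ + _).
(* For fixed k, the inner sum over r < N exceeds the range r <= N - k only by zero terms. *)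
rewrite exchange_big /=; apply: eq_big_nat => k /andP[k2 kN].
rewrite -mulr_sumr comps_series_widen //; lia.
Qed.

End Compositions.

(** * The identity for truncated sums and its passage to the limit *)

Section Main.
Variable R : realType.

(** Induction on the length of the interval, for all [a], since removing the smallest integer a + 1
    moves the left end. Both sides satisfy the same step recurrence with y = 1 / (a + 1). *)
Lemma mz_trunc_product b a :
  comps_series (fun ks => mz_trunc R false ks b a) =1
  fps_mul (fps_sum 0 2 (fun n => mz_trunc R true (nseq n 2) b a))
          (fps_sum 0 3 (fun n => mz_trunc R false (nseq n 3) b a)).
Proof.
elim: b a => [|b IHb] a.
  (* On the empty interval only the empty index contributes, so all three series are 1. *)
  move=> N; rewrite (eq_fps_mul (fps_sum_one _ _ _) (fps_sum_one _ _ _)) // fps_mul1.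
  rewrite /comps_series big_nat_recl //= mulr1 big1 ?addr0 // => r _.
  by rewrite big1 // => k _; rewrite comp_sum0.
apply: (fps_step_unique (y := a.+1%:R^-1) (IHb a.+1)).
  apply: fps_geometric_step.
  by apply: comps_series_rec => // k ks /=; rewrite exprVn.
by apply: fps_mul_step; apply: fps_sum_rec => // n /=; rewrite exprVn.
Qed.

Lemma comps_series_cvg N :
  comps_series (fun ks => mz_trunc R false ks b 0) N @[b --> \oo] -->
  comps_series (mzv R) N.
Proof.
apply: cvg_big => [|r _]; first exact: add_continuous.
by apply: comp_sum_cvg => ks; exact: mzv_trunc_cvg.
Qed.

Lemma fps_sum_cvg n0 d N (c : nat -> nat -> R) (c' : nat -> R) :
  (forall n, c n b @[b --> \oo] --> c' n) ->
  fps_sum n0 d (fun n => c n b) N @[b --> \oo] --> fps_sum n0 d c' N.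
Proof.
by move=> cc; apply: cvg_big => [|n _]; [exact: add_continuous|exact: cc].
Qed.

Lemma fps_mul_cvg N (f g : nat -> fps R) (f' g' : fps R) :
  (forall n, f b n @[b --> \oo] --> f' n) ->
  (forall n, g b n @[b --> \oo] --> g' n) ->
  fps_mul (f b) (g b) N @[b --> \oo] --> fps_mul f' g' N.
Proof.
move=> ff gg; apply: cvg_big => [|i _]; first exact: add_continuous.
by apply: cvgM; [exact: ff | exact: gg].
Qed.

(** The truncations at the empty index are constantly 1. This lets the leading 1 of a series be
    absorbed as its term of index 0. *)
Lemma mzv_nil : mzv R [::] = 1.
Proof. exact: (cvg_unique _ (@mzv_trunc_cvg R [::] isT) (cvg_cst _)). Qed.

Lemma mzsv_nil : mzsv R [::] = 1.
Proof. exact: (cvg_unique _ (@mzsv_trunc_cvg R [::] isT) (cvg_cst _)). Qed.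

Lemma mzv_sumE N : mzv_sum R N = \sum_(0 <= r < N) comp_sum r.+1 N (mzv R).
Proof.
rewrite /mzv_sum big_add1; apply: eq_bigr => r _.
exact: comp_sum_tuple.
Qed.

Lemma comps_series_mzv :
  fps_add (fps_one R) (fps_sum 2 1 (mzv_sum R)) =1 comps_series (mzv R).
Proof.
move=> N; rewrite /comps_series big_nat_recl //= mzv_nil mulr1; congr (_ + _).
rewrite -[RHS]/(\sum_(0 <= r < N) comp_sum r.+1 N (mzv R)) -mzv_sumE /fps_sum.
(* For N < 2 the left series has no term, and N has no composition into one or more parts at least
   2. *)
case: (ltnP N 2) => N2.
  rewrite big_geq // mzv_sumE big1 // => r _ /=.
  by rewrite big_geq.
rewrite big_mkcond (bigD1_seq N) ?iota_uniq ?mem_index_iota ?N2 //= mul1n eqxx.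
by rewrite big1 ?addr0 // => n nN; rewrite mul1n (negbTE nN).
Qed.

End Main.

Theorem theorem3 (R : realType) :
  fps_add (fps_one R) (fps_sum 2 1 (mzv_sum R)) =
  fps_mul
    (fps_add (fps_one R) (fps_sum 1 2 (fun n : nat => mzsv R (nseq n 2))))
    (fps_add (fps_one R) (fps_sum 1 3 (fun n : nat => mzv R (nseq n 3)))).
Proof.
apply/funext => N; rewrite comps_series_mzv.
have -> : fps_add (fps_one R) (fps_sum 1 2 (fun n => mzsv R (nseq n 2))) =
          fps_sum 0 2 (fun n => mzsv R (nseq n 2)).
  by apply/funext; apply: fps_sum_split; exact: mzsv_nil.
have -> : fps_add (fps_one R) (fps_sum 1 3 (fun n => mzv R (nseq n 3))) =
          fps_sum 0 3 (fun n => mzv R (nseq n 3)).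
  by apply/funext; apply: fps_sum_split; exact: mzv_nil.
set rhs := fps_mul _ _ N.
(* The left coefficient is already the limit of these truncations, so uniqueness of limits
   concludes. *)
suff rhs_cvg : comps_series (fun ks => mz_trunc R false ks b 0) N @[b --> \oo] --> rhs.
  exact: (cvg_unique _ (@comps_series_cvg R N) rhs_cvg).
under eq_fun do rewrite mz_trunc_product.
apply: fps_mul_cvg => n; apply: fps_sum_cvg => m.
  by apply: mzsv_trunc_cvg; rewrite all_nseq orbT.
by apply: mzv_trunc_cvg; rewrite all_nseq orbT.
Qed.
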